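(* Let $n,m$ be positive integers such that $n,m\geq 3$ and $n\neq m$. Then the complete bipartite graph $K_{n,m}$ is a weak ordered super TAT graph; that is, $K_{n,m}$ admits a total labeling that is simultaneously super, totally antimagic total, and weak ordered.
   Context: All graphs are finite, undirected and simple. $K_{n,m}$ is the complete bipartite graph with partite sets of sizes $n$ and $m$. Let $G$ be a graph with $p=|V(G)|$ vertices and $q=|E(G)|$ edges. A total labeling of $G$ is a bijection $f:V(G)\cup E(G)\to\{1,2,\dots,p+q\}$. It is super if $f(V(G))=\{1,2,\dots,p\}$. The edge-weight of $uv\in E(G)$ is $wt_f(uv)=f(u)+f(uv)+f(v)$, and the vertex-weight of $v\in V(G)$ is $wt_f(v)=f(v)+\sum_{u\in N(v)}f(uv)$, where $N(v)$ is the set of neighbors of $v$. The labeling $f$ is edge-antimagic total (EAT) if all edge-weights are pairwise distinct, and vertex-antimagic total (VAT) if all vertex-weights are pairwise distinct. It is totally antimagic total (TAT) if it is both EAT and VAT. A labeling $f$ is ordered on a set $S$ of vertices if $wt_f(u)\le wt_f(v)$ for every pair $u,v\in S$ with $f(u)<f(v)$. A labeling $f$ of $G$ is weak ordered if, for some positive integer $k$, the vertex set $V(G)$ can be partitioned into $k$ sets on each of which $f$ is ordered. A graph is a weak ordered super TAT graph if it admits a total labeling that is weak ordered, super and TAT. *)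

(* Defs.v *)
From mathcomp Require Import all_boot.

Set Implicit Arguments.
Unset Strict Implicit.
Unset Printing Implicit Defensive.

Record sgraph := SGraph {
  vertex :> finType;
  adj : rel vertex;
  adj_sym : symmetric adj;
  adj_irrefl : irreflexive adj
}.

Section Labeling.
Variable G : sgraph.

(* The edge uv is the two-element set [set u; v]. *)
Definition edges : {set {set G}} :=
  [set A | [exists u : G, exists v : G, adj u v && (A == [set u; v])]].

Definition elements : {set G + {set G}} :=
  [set inl v | v in [set: G]] :|: [set inr A | A in edges].

(* A labeling is a function on all of G + {set G}; only its values on
   [elements] are constrained or used. *)
Implicit Type f : G + {set G} -> nat.

Definition total_labeling f : Prop :=
  {in elements &, injective f} /\
  forall k, (exists2 x, x \in elements & f x = k) <-> 1 <= k <= #|G| + #|edges|.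

Definition super f : Prop :=
  forall k, (exists v : G, f (inl v) = k) <-> 1 <= k <= #|G|.

Definition edge_weight f (u v : G) : nat :=
  f (inl u) + f (inr [set u; v]) + f (inl v).

Definition vertex_weight f (v : G) : nat :=
  f (inl v) + \sum_(u : G | adj v u) f (inr [set u; v]).

Definition edge_antimagic f : Prop :=
  forall u v x y : G, adj u v -> adj x y ->
    [set u; v] != [set x; y] -> edge_weight f u v <> edge_weight f x y.

Definition vertex_antimagic f : Prop :=
  forall u v : G, u != v -> vertex_weight f u <> vertex_weight f v.

Definition totally_antimagic f : Prop :=
  edge_antimagic f /\ vertex_antimagic f.

Definition ordered_on f (S : {set G}) : Prop :=
  forall u v : G, u \in S -> v \in S ->
    f (inl u) < f (inl v) -> vertex_weight f u <= vertex_weight f v.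

(* k is not bounded, so the partition into singletons always qualifies. *)
Definition weak_ordered f : Prop :=
  exists2 k : nat, 0 < k &
    exists P : {set {set G}},
      [/\ partition P [set: G], #|P| = k
        & forall S : {set G}, S \in P -> ordered_on f S].

Definition weak_ordered_super_TAT_graph : Prop :=
  exists f, [/\ total_labeling f, weak_ordered f, super f
              & totally_antimagic f].

End Labeling.

Section CompleteBipartite.
Variables n m : nat.

Definition Knm_adj : rel ('I_n + 'I_m) := fun x y =>
  match x, y with
  | inl _, inr _ | inr _, inl _ => true
  | _, _ => false
  end.

Lemma Knm_adj_sym : symmetric Knm_adj.
Proof. by case=> ? [] ?. Qed.

Lemma Knm_adj_irrefl : irreflexive Knm_adj.
Proof. by case. Qed.

Definition Knm : sgraph := SGraph Knm_adj_sym Knm_adj_irrefl.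

End CompleteBipartite.

(* Main.v *)
(* By symmetry n > m = q + 1.  View the edges of K_{n,m} as the cells of an
   n x m array.  Apart from the last column the edge labels increase row by row,
   and the last column receives the n largest labels.  The vertex labels are
   increasing on rows, the last column has the largest one, and the other columns
   get a permutation s of the smallest q for which j + s j is injective modulo
   q + 1; as successive rows raise the edge-weights by q + 1, these weights are
   distinct, and the jump of n vertex labels puts the last column above them.

   In the last column, label order may be rotated by any k along an odd number
   n - o of rows (o <= 1): i + (rotated i) stays injective by parity.  This leaves
   all column weights but the last unchanged, and the last is the largest of all
   vertex-weights.  If n > q^2 + 1, with k = 0 all rows are lighter than all
   columns; otherwise each of the q columns meets a row for at most one k, and
   some k < n - o avoids every collision.  When o = 1 the unrotated row is
   harmless, being lighter than every column. *)
Require Import Defs.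
From mathcomp Require Import all_boot.
From mathcomp Require Import zify.

(** * Counting, weak order, and the labeling conditions in numeric form *)

Lemma mem_iff_injective_range (T : finType) (A : {set T}) (f : T -> nat) :
    {in A &, injective f} -> {in A, forall x, 1 <= f x <= #|A|} ->
  forall k, (exists2 x, x \in A & f x = k) <-> 1 <= k <= #|A|.
Proof.
move=> finj frng k.
have sub : {subset [seq f x | x in A] <= iota 1 #|A|}.
  by move=> _ /imageP[x xA ->]; rewrite mem_iota add1n ltnS frng.
have [||_ e] := uniq_min_size _ sub.
- by apply/dinjectiveP.
- by rewrite size_iota size_image.
split=> [[x xA <-]|kA]; first exact: frng.
have /imageP[x xA ->] : k \in [seq f x | x in A] by rewrite e mem_iota add1n ltnS.
by exists x.
Qed.

(* The number of classes being free, the partition into singletons works. *)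
Lemma weak_orderedT (G : sgraph) (v : G) (f : G + {set G} -> nat) :
  weak_ordered f.
Proof.
pose P := [set [set x] | x in [set: G]].
exists #|P|; first by apply/card_gt0P; exists [set v]; apply: imset_f.
exists P; split=> //; last first.
  by move=> _ /imsetP[x _ ->] u w /set1P-> /set1P->; rewrite ltnn.
apply/and3P; split.
- apply/eqP/setP=> x; rewrite inE; apply/bigcupP.
  by exists [set x]; rewrite ?set11 ?imset_f.
- apply/trivIsetP=> _ _ /imsetP[x _ ->] /imsetP[y _ ->] xy.
  by rewrite disjoints1 inE; apply: contraNneq xy => ->.
- by apply/imsetP=> -[x _ /setP/(_ x)]; rewrite !inE eqxx.
Qed.

(** Arithmetic form of a super TAT labeling: [a] and [b] label the two sides, [g i j] the edge
    between [i] and [j]. Surjectivity will follow from injectivity and range by counting. *)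
Record good_labels (n m : nat) (a b : nat -> nat) (g : nat -> nat -> nat) :
    Prop := GoodLabels {
  a_rng : forall i, i < n -> 1 <= a i <= n + m;
  b_rng : forall j, j < m -> 1 <= b j <= n + m;
  a_inj : forall i i', i < n -> i' < n -> a i = a i' -> i = i';
  b_inj : forall j j', j < m -> j' < m -> b j = b j' -> j = j';
  ab_neq : forall i j, i < n -> j < m -> a i <> b j;
  g_rng : forall i j, i < n -> j < m -> n + m < g i j <= n + m + n * m;
  g_inj : forall i i' j j', i < n -> i' < n -> j < m -> j' < m ->
    g i j = g i' j' -> i = i' /\ j = j';
  edge_inj : forall i i' j j', i < n -> i' < n -> j < m -> j' < m ->
    a i + g i j + b j = a i' + g i' j' + b j' -> i = i' /\ j = j';
  row_inj : forall i i', i < n -> i' < n ->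
    a i + \sum_(j < m) g i j = a i' + \sum_(j < m) g i' j -> i = i';
  col_inj : forall j j', j < m -> j' < m ->
    b j + \sum_(i < n) g i j = b j' + \sum_(i < n) g i j' -> j = j';
  row_col : forall i j, i < n -> j < m ->
    a i + \sum_(j < m) g i j <> b j + \sum_(i < n) g i j }.

Lemma good_labelsC n m a b g :
  good_labels n m a b g -> good_labels m n b a (fun j i => g i j).
Proof.
case=> h1 h2 h3 h4 h5 h6 h7 h8 h9 h10 h11; split=> //.
- by move=> i; rewrite addnC; apply: h2.
- by move=> i; rewrite addnC; apply: h1.
- by move=> i j hi hj /esym; apply: h5.
- by move=> i j hi hj; rewrite mulnC (addnC m); apply: h6.
- by move=> i i' j j' hi hi' hj hj' /h7[].
- move=> i i' j j' hi hi' hj hj' e.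
  by have [|||||-> ->] := h8 j j' i i' => //; lia.
- by move=> i j hi hj /esym; apply: h11.
Qed.

(** * Transfer of numeric labels to the graph *)

Section Realization.
Variables n m : nat.
Implicit Types (i : 'I_n) (j : 'I_m).

Definition Kedge (ij : 'I_n * 'I_m) : {set Knm n m} :=
  [set inl ij.1; inr ij.2].

Lemma Kedge_inj : injective Kedge.
Proof.
move=> [i j] [i' j'] /setP e.
move: (e (inl i)) (e (inr j)); rewrite !inE !eqxx /= orbF.
by move=> /esym/eqP[->] /esym/eqP[->].
Qed.

Lemma edgesE : edges (Knm n m) = [set Kedge ij | ij in [set: 'I_n * 'I_m]].
Proof.
apply/setP=> A; rewrite inE; apply/existsP/imsetP.
  case=> -[i|j] /existsP[[i'|j'] /andP[//= _ /eqP->]].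
  - by exists (i, j'); rewrite ?inE.
  - by exists (i', j); rewrite ?inE // /Kedge setUC.
move=> [[i j] _ ->]; exists (inl i); apply/existsP; exists (inr j).
by rewrite eqxx.
Qed.

Lemma card_edges_Knm : #|edges (Knm n m)| = n * m.
Proof.
by rewrite edgesE (card_imset _ Kedge_inj) cardsT card_prod !card_ord.
Qed.

Lemma card_vertices_Knm : #|Knm n m| = n + m.
Proof. by rewrite card_sum !card_ord. Qed.

Lemma card_elements (G : sgraph) : #|elements G| = #|G| + #|edges G|.
Proof.
rewrite cardsU (_ : _ :&: _ = set0) ?cards0 ?subn0.
  by rewrite !card_imset ?cardsT //; [move=> ? ? []|move=> ? ? []].
apply/setP=> x; rewrite !inE; apply/andP=> -[/imsetP[? _ ->]].
by case/imsetP.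
Qed.

Variables (a b : nat -> nat) (g : nat -> nat -> nat).

(** The default 0 is met only on sets that are not edges, where labels are unconstrained. *)
Definition Klabel (x : Knm n m + {set Knm n m}) : nat :=
  match x with
  | inl (inl i) => a i
  | inl (inr j) => b j
  | inr A => if [pick ij | A == Kedge ij] is Some ij then g ij.1 ij.2 else 0
  end.

Lemma Klabel_edge i j : Klabel (inr [set inl i; inr j]) = g i j.
Proof.
rewrite /Klabel; case: pickP => [ij /eqP/(@Kedge_inj (i, j)) <- //|/(_ (i, j))].
by rewrite eqxx.
Qed.

Lemma Klabel_edgeC i j : Klabel (inr [set inr j; inl i]) = g i j.
Proof. by rewrite setUC Klabel_edge. Qed.

Lemma vertex_weight_l i : vertex_weight (G := Knm n m) Klabel (inl i) =
  a i + \sum_(j < m) g i j.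
Proof.
rewrite /vertex_weight big_sumType /= big_pred0 // add0n; congr addn.
by apply: eq_bigr => j _; apply: Klabel_edgeC.
Qed.

Lemma vertex_weight_r j : vertex_weight (G := Knm n m) Klabel (inr j) =
  b j + \sum_(i < n) g i j.
Proof.
rewrite /vertex_weight big_sumType /= [X in _ + (_ + X)]big_pred0 // addn0.
by congr addn; apply: eq_bigr => i _; apply: Klabel_edge.
Qed.

Lemma Knm_adjP (u v : Knm n m) : adj u v -> exists i j,
  [set u; v] = Kedge (i, j) /\
  edge_weight (G := Knm n m) Klabel u v = a i + g i j + b j.
Proof.
case: u v => [i|j] [i'|j'] //= _.
  by exists i, j'; split=> //; rewrite /edge_weight Klabel_edge.
exists i', j; split; first by rewrite /Kedge setUC.
by rewrite /edge_weight Klabel_edgeC /=; lia.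
Qed.

Lemma Knm_weak_ordered_super_TAT :
  0 < n -> good_labels n m a b g -> weak_ordered_super_TAT_graph (Knm n m).
Proof.
move=> n0 [a_r b_r a_i b_i ab g_r g_i e_i r_i c_i rc].
have vrng (v : Knm n m) : 1 <= Klabel (inl v) <= n + m.
  by case: v => [i|j]; [apply: a_r | apply: b_r].
have vinj : injective (fun v : Knm n m => Klabel (inl v)).
  move=> [i|j] [i'|j'] /= e.
  - by congr inl; apply: ord_inj; apply: a_i.
  - by case: (ab i j').
  - by case: (ab i' j).
  - by congr inr; apply: ord_inj; apply: b_i.
have edgeP A : A \in edges (Knm n m) ->
    exists i j, A = Kedge (i, j) /\ Klabel (inr A) = g i j.
  by rewrite edgesE => /imsetP[[i j] _ ->]; exists i, j; rewrite Klabel_edge.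
have erng A : A \in edges (Knm n m) -> n + m < Klabel (inr A) <= n + m + n * m.
  by case/edgeP=> i [j [_ ->]]; apply: g_r.
(* Keeps the two kinds of labels apart, so injectivity on vertices and on edges gives injectivity on
   all elements. *)
have vlte v A : A \in edges (Knm n m) -> Klabel (inl v) < Klabel (inr A).
  by move=> /erng/andP[+ _]; apply: leq_ltn_trans; case/andP: (vrng v).
have elemP x : x \in elements (Knm n m) ->
    (exists v, x = inl v) \/ exists2 A, A \in edges (Knm n m) & x = inr A.
  by rewrite inE => /orP[]/imsetP[y yP ->]; [left; exists y | right; exists y].
exists Klabel; split.
- have inj : {in elements (Knm n m) &, injective Klabel}.
    move=> x y /elemP[[u ->]|[A hA ->]] /elemP[[v ->]|[B hB ->]] e.
    + by congr inl; apply: vinj.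
    + by have := vlte u _ hB; rewrite e ltnn.
    + by have := vlte v _ hA; rewrite -e ltnn.
    + move: e; have [i [j [-> ->]]] := edgeP _ hA.
      have [i' [j' [-> ->]]] := edgeP _ hB.
      by case/g_i => // /ord_inj-> /ord_inj->.
  split=> //; rewrite -card_elements; apply: mem_iff_injective_range => //.
  move=> x; rewrite card_elements card_edges_Knm card_vertices_Knm.
  case/elemP=> [[u ->]|[A hA ->]].
    by case/andP: (vrng u) => -> /leq_trans-> //; apply: leq_addr.
  by case/andP: (erng _ hA) => /(leq_ltn_trans (leq0n _))-> ->.
- exact: (weak_orderedT (Knm n m) (inl (Ordinal n0))).
- move=> k; rewrite -cardsT -(@mem_iff_injective_range (Knm n m) _
    (fun v : Knm n m => Klabel (inl v))).
  + by split=> [[v <-]|[v _ <-]]; exists v.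
  + by move=> u v _ _; apply: vinj.
  + by move=> v _; rewrite cardsT card_vertices_Knm.
- split.
    move=> u v x y /Knm_adjP[i [j [-> ->]]] /Knm_adjP[i' [j' [-> ->]]].
    by move=> /eqP ne /e_i[] // /ord_inj ei /ord_inj ej; rewrite ei ej in ne.
  move=> [i|j] [i'|j'] /eqP ne; rewrite ?vertex_weight_l ?vertex_weight_r.
  + by move/r_i => h; apply: ne; congr inl; apply: ord_inj; apply: h.
  + exact: rc.
  + by move/esym; apply: rc.
  + by move/c_i => h; apply: ne; congr inr; apply: ord_inj; apply: h.
Qed.

End Realization.

(** * Rotations and the column permutation *)

Definition rotate_from (o n k i : nat) : nat :=
  if i < o then i else o + (i - o + k) %% (n - o).

Lemma modn_rotate l k u : u < l -> k < l ->
  (u + k) %% l = if u + k < l then u + k else u + k - l.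
Proof.
move=> ul kl; case: ltnP => h; first by rewrite modn_small.
by rewrite -{1}(subnK h) modnDr modn_small //; lia.
Qed.

Lemma rotate_fromE o n k i : o + k < n -> i < n -> rotate_from o n k i =
  if i < o then i else if i + k < n then i + k else i + k - (n - o).
Proof.
move=> kn ni; rewrite /rotate_from; case: ltnP => // oi.
by rewrite modn_rotate; [do 2?case: ifP => ?; lia|lia|lia].
Qed.

Lemma rotate_from_lt o n k i : o + k < n -> i < n -> rotate_from o n k i < n.
Proof. by move=> kn ni; rewrite rotate_fromE //; do 2?case: ifP => ?; lia. Qed.

Lemma rotate_from_inj o n k i i' : o + k < n -> i < n -> i' < n ->
  rotate_from o n k i = rotate_from o n k i' -> i = i'.
Proof. by move=> kn ni ni'; rewrite !rotate_fromE //; do 4?case: ifP => ?; lia. Qed.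

(** A moved index gives 2i + k or 2i + k - (n - o), of different parities as n - o is odd. Fixed
    indices give sums below 2o, moved ones at least 2o. *)
Lemma add_rotate_from_inj o n k i i' : odd (n - o) -> o + k < n ->
    i < n -> i' < n ->
  i + rotate_from o n k i = i' + rotate_from o n k i' -> i = i'.
Proof.
by move=> on kn ni ni'; rewrite !rotate_fromE //; do 4?case: ifP => ?; lia.
Qed.

Lemma rotate_from_shift_inj o n k k' i : o <= i < n -> o + k < n ->
  o + k' < n -> rotate_from o n k i = rotate_from o n k' i -> k = k'.
Proof.
by move=> /andP[oi ni] kn kn'; rewrite !rotate_fromE //; do 4?case: ifP => ?; lia.
Qed.

Lemma rotate_from0 o n i : o < n -> i < n -> rotate_from o n 0 i = i.
Proof. by move=> on ni; rewrite rotate_fromE ?addn0 ?ni // if_same. Qed.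

(** For even q the identity works, as 2 is invertible modulo q + 1. For q = 2k + 1, rotation by k
    makes the sums run once through k, ..., 3k, which is only q consecutive values. *)
Lemma exists_permutation_add_mod_inj q : exists s : nat -> nat,
  [/\ forall j, j < q -> s j < q,
      forall j j', j < q -> j' < q -> s j = s j' -> j = j'
    & forall j j', j < q -> j' < q ->
        j + s j = j' + s j' %[mod q.+1] -> j = j'].
Proof.
case: q => [|q']; first by exists id; split.
pose q := q'.+1; rewrite -/q.
pose k := if odd q then q./2 else 0.
have kq : 0 + k < q by rewrite /k /q; case: ifP; lia.
exists (rotate_from 0 q k); split.
- by move=> j hj; apply: rotate_from_lt.
- by move=> j j' hj hj'; apply: rotate_from_inj.
move=> j j' hj hj' /eqP e.
(* Both sums are below 2(q + 1), so if congruent they are equal or differ by exactly q + 1. *)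
have cases : [\/ j + rotate_from 0 q k j = j' + rotate_from 0 q k j',
    j + rotate_from 0 q k j = j' + rotate_from 0 q k j' + q.+1
  | j' + rotate_from 0 q k j' = j + rotate_from 0 q k j + q.+1].
  have := rotate_from_lt _ _ _ _ kq hj; have := rotate_from_lt _ _ _ _ kq hj'.
  move: e; set x := j + _; set y := j' + _ => e h1 h2.
  have : x < q.+1 + q.+1 by lia.
  have : y < q.+1 + q.+1 by lia.
  move: e; rewrite (divn_eq x q.+1) (divn_eq y q.+1) !modnMDl !modn_mod.
  move=> /eqP ->.
  case: (x %/ q.+1) => [|[|?]]; case: (y %/ q.+1) => [|[|?]]; try lia.
  + by move=> _ _; constructor 1.
  + by move=> _ _; constructor 3; lia.
  + by move=> _ _; constructor 2; lia.
  + by move=> _ _; constructor 1.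
have kE : odd q /\ q = k.*2.+1 \/ ~~ odd q /\ k = 0.
  by rewrite /k; case: ifP => oq; [left|right]; lia.
clearbody k q; move: cases; rewrite !rotate_fromE //.
by do 4?case: ifP => ?; case; lia.
Qed.

(** * Sums and polynomial inequalities between weights *)

Lemma sum_ord_id n : (\sum_(i < n) i) * 2 + n = n * n.
Proof.
elim: n => [|n]; rewrite ?big_ord0 // big_ord_recr /=.
by set S := \sum_(i < n) i; lia.
Qed.

Lemma sum_ord_affine n c d : \sum_(i < n) (c + i * d) = n * c + d * \sum_(i < n) i.
Proof. by rewrite big_split /= sum_nat_const card_ord (mulnC d) big_distrl. Qed.

(** Since n >= q + 2, the term n^2 q on the right beats n q^2 on the left. Substituting q = 2 + e
    and n = q + 2 + d builds the hypotheses into the polynomials. *)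
Lemma last_col_bound n q x y T : 2 <= q -> q.+2 <= n ->
    T * 2 + q = q * q -> x <= n.-1 * (q * q).+1 -> y < n ->
  x + y + (q.+1 + (q * (n + q.+1).+1 + T) + ((n + q.+1).+1 + n * q))
  < n + q.+1 + n * ((n + q.+1).+1 + n * q).
Proof.
by move=> /subnKC <- /subnKC <-; set e := q - 2; set d := n - _; lia.
Qed.

Lemma first_row_bound n q y T U : 2 <= q -> q.+2 <= n ->
    T * 2 + q = q * q -> U * 2 + n = n * n -> y < n ->
  y + (q.+1 + (q * (n + q.+1).+1 + T) + ((n + q.+1).+1 + n * q))
  < (n * (n + q.+1).+1 + q * U).+1.
Proof.
move=> /subnKC <- /subnKC <-; set e := q - 2; set d := n - _ => hT hU hy.
have := congr1 (muln (2 + e)) hU; rewrite mulnDr mulnA.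
by set V := (2 + e) * U; lia.
Qed.

(** As q >= 2, the term q U is at least n(n - 1) and covers [x]; the term n(n + q + 2) covers the
    rest. *)
Lemma tall_bound n q x T U : 2 <= q -> (q * q).+2 <= n ->
    T * 2 + q = q * q -> U * 2 + n = n * n -> x <= n.-1 * n ->
  x + (q.+1 + (q * (n + q.+1).+1 + T) + ((n + q.+1).+1 + n * q))
  < (n * (n + q.+1).+1 + q * U).+1.
Proof.
move=> /subnKC <- /subnKC <-; set e := q - 2; set d := n - _ => hT hU hx.
have := congr1 (muln (2 + e)) hU; rewrite mulnDr mulnA.
by set V := (2 + e) * U; lia.
Qed.

Lemma col_last_bound n q x j U : 2 <= q -> q.+2 <= n ->
    U * 2 + n = n * n -> x < q -> j < q ->
  x + n * j + (n * (n + q.+1).+1 + q * U).+1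
  < n + q.+1 + n * ((n + q.+1).+1 + n * q).
Proof.
move=> q2 nq hU hx hj.
have : n * j <= n * q by rewrite leq_mul2l; lia.
set X := n * j; move: q2 nq hU hx.
move=> /subnKC <- /subnKC <-; set e := q - 2; set d := n - _ => hU hx.
have := congr1 (muln (2 + e)) hU; rewrite mulnDr mulnA.
by set V := (2 + e) * U; lia.
Qed.

(** * The labeling for a given permutation and shift *)

Section Construction.
Variables (n q o k : nat) (s : nat -> nat).
Hypotheses (q_ge2 : 2 <= q) (n_gt : q.+2 <= n).
Hypotheses (odd_no : odd (n - o)) (k_lt : o + k < n).
Hypotheses (s_lt : forall j, j < q -> s j < q).
Hypothesis s_inj : forall j j', j < q -> j' < q -> s j = s j' -> j = j'.
Hypothesis add_s_inj : forall j j', j < q -> j' < q ->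
  j + s j = j' + s j' %[mod q.+1] -> j = j'.

Let p := n + q.+1.
Let r := rotate_from o n k.

Definition vlabel_l i := q.+1 + i.
Definition vlabel_r j := if j < q then (s j).+1 else p.
Definition elabel i j := if j < q then p.+1 + i * q + j else p.+1 + n * q + r i.

(** The parts of the row-weights, and of the column-weights outside the last column, that are the
    same for all rows or columns. *)
Definition row_base := q.+1 + (q * p.+1 + \sum_(j < q) j) + (p.+1 + n * q).
Definition col_base := (n * p.+1 + q * \sum_(i < n) i).+1.

(** The index i enters q cells as i*q and the vertex label once, whence q^2 + 1; [r i] comes from
    the last cell alone. *)
Lemma row_weight i : vlabel_l i + \sum_(j < q.+1) elabel i j =
  i * (q * q).+1 + r i + row_base.
Proof.
rewrite big_ord_recr /= /elabel ltnn.
under eq_bigr => j _ do rewrite ltn_ord -[nat_of_ord j]muln1.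
rewrite sum_ord_affine /vlabel_l /row_base.
by set T := \sum_(j < q) j; lia.
Qed.

Lemma col_weight j : j < q -> vlabel_r j + \sum_(i < n) elabel i j =
  s j + n * j + col_base.
Proof.
move=> hj; rewrite /elabel /vlabel_r hj.
under eq_bigr => i _ do rewrite addnAC.
rewrite sum_ord_affine /col_base.
by set T := \sum_(i < n) i; lia.
Qed.

(** Dropping the rotated terms leaves a bound that does not depend on the shift and still exceeds
    all other weights. *)
Lemma last_col_weight :
  p + n * (p.+1 + n * q) <= vlabel_r q + \sum_(i < n) elabel i q.
Proof.
rewrite /elabel /vlabel_r ltnn leq_add2l.
rewrite -[X in X * _]card_ord -sum_nat_const.
by apply: leq_sum => i _; apply: leq_addr.
Qed.

Lemma row_lt_last_col i : i < n ->
  i * (q * q).+1 + r i + row_base < p + n * (p.+1 + n * q).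
Proof.
move=> hi; apply: last_col_bound => //; first exact: sum_ord_id.
  by rewrite leq_mul2r; lia.
exact: rotate_from_lt.
Qed.

Lemma col_lt_last_col j : j < q ->
  s j + n * j + col_base < p + n * (p.+1 + n * q).
Proof.
move=> hj; apply: col_last_bound => //; first exact: sum_ord_id.
exact: s_lt.
Qed.

Lemma row0_lt_col j : r 0 + row_base < s j + n * j + col_base.
Proof.
apply: leq_trans (leq_addl _ col_base); apply: first_row_bound => //.
- exact: sum_ord_id.
- exact: sum_ord_id.
- by apply: rotate_from_lt => //; lia.
Qed.

Lemma row_lt_col i j : (q * q).+1 < n -> k = 0 -> i < n ->
  i * (q * q).+1 + r i + row_base < s j + n * j + col_base.
Proof.
move=> nq k0 hi; have -> : r i = i by rewrite /r k0 rotate_from0 //; lia.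
apply: leq_trans (leq_addl _ col_base); apply: tall_bound => //.
- exact: sum_ord_id.
- exact: sum_ord_id.
- by rewrite addnC -mulnS leq_mul //; lia.
Qed.

(** The two hypotheses isolate what depends on the shift and on the size of n against q^2; the rest
    holds for every admissible shift. *)
Lemma construction_good :
    (forall i i', i < n -> i' < n ->
      i * (q * q).+1 + r i = i' * (q * q).+1 + r i' -> i = i') ->
    (forall i j, i < n -> j < q ->
      i * (q * q).+1 + r i + row_base <> s j + n * j + col_base) ->
  good_labels n q.+1 vlabel_l vlabel_r elabel.
Proof.
move=> row_inj row_col.
have rlt i : i < n -> r i < n by apply: rotate_from_lt.
have cellE i j : i < n -> j < q -> i * q + j < n * q.
  move=> hi hj; apply: (@leq_trans (i.+1 * q)); first by rewrite mulSn; lia.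
  by rewrite leq_mul2r hi orbT.
have cell_inj i i' j j' : j < q -> j' < q ->
    i * q + j = i' * q + j' -> i = i' /\ j = j'.
  move=> hj hj' e; have := congr1 (modn^~ q) e.
  rewrite !modnMDl !modn_small // => ej; split=> //; move: e; rewrite ej.
  by move=> /addIn/eqP; rewrite eqn_mul2r => /orP[|/eqP//]; lia.
split.
- by move=> i; rewrite /vlabel_l; lia.
- by move=> j; rewrite /vlabel_r /p; case: ifP => [/s_lt|]; lia.
- by move=> i i' _ _; rewrite /vlabel_l; lia.
- move=> j j'; rewrite /vlabel_r /p => hj hj'.
  case: ifP => hjq; case: ifP => hjq'; try lia.
  + by case=> /s_inj; apply.
  + by have := s_lt _ hjq; lia.
  + by have := s_lt _ hjq'; lia.
- move=> i j hi hj; rewrite /vlabel_l /vlabel_r /p.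
  by case: ifP => [/s_lt|]; lia.
- move=> i j hi hj; rewrite /elabel /p.
  case: ifP => hjq; first by have := cellE _ _ hi hjq; lia.
  by have := rlt _ hi; lia.
- move=> i i' j j' hi hi' hj hj'; rewrite /elabel.
  case: ifP => hjq; case: ifP => hjq'.
  + by move=> e; apply: cell_inj => //; lia.
  + by have := cellE _ _ hi hjq; lia.
  + by have := cellE _ _ hi' hjq'; lia.
  + move=> e; split; last lia.
    by apply: (rotate_from_inj o n k) => //; rewrite -/r; lia.
- move=> i i' j j' hi hi' hj hj'; rewrite /vlabel_l /vlabel_r /elabel.
  (* Up to a common constant, an edge outside the last column weighs less than n*q + p, which every
     edge of the last column reaches. *)
  have core_lt u v : u < n -> v < q -> (u * q + u + v + s v).+1 < n * q + p.
    move=> hu hv; have := s_lt _ hv; have := cellE _ _ hu hv; rewrite /p; lia.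
  case: ifP => hjq; case: ifP => hjq' e.
  + have {}e : i * q.+1 + (j + s j) = i' * q.+1 + (j' + s j').
      by rewrite !mulnS; lia.
    have ej : j = j'.
      apply: add_s_inj => //; have := congr1 (modn^~ q.+1) e.
      by rewrite !modnMDl.
    split=> //; move: e; rewrite ej => /addIn/eqP.
    by rewrite eqn_mul2r => /orP[|/eqP//]; lia.
  + by have := core_lt _ _ hi hjq; lia.
  + by have := core_lt _ _ hi' hjq'; lia.
  + split; last lia.
    by apply: (add_rotate_from_inj o n k) => //; rewrite -/r; lia.
- move=> i i' hi hi'; rewrite !row_weight => /addIn; exact: row_inj.
- move=> j j' hj hj'.
  have hl := last_col_weight.
  have [hjq|hjq] := ltnP j q; have [hjq'|hjq'] := ltnP j' q.
  + rewrite !col_weight // => /addIn e.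
    (* As s j < q < n, it is the residue of s j + n*j modulo n. *)
    have ej : s j = s j'.
      have := congr1 (modn^~ n) e.
      rewrite ![_ + n * _]addnC ![n * _]mulnC !modnMDl.
      by rewrite !modn_small //; [have := s_lt _ hjq'|have := s_lt _ hjq]; lia.
    exact: s_inj ej.
  + have -> : j' = q by lia.
    by rewrite (col_weight _ hjq) => e; move: hl; rewrite -e leqNgt col_lt_last_col.
  + have -> : j = q by lia.
    by rewrite (col_weight _ hjq') => e; move: hl; rewrite e leqNgt col_lt_last_col.
  + by lia.
- move=> i j hi hj; rewrite row_weight.
  have [hjq|hjq] := ltnP j q; first by rewrite col_weight //; apply: row_col.
  have -> : j = q by lia.
  by move=> e; have := last_col_weight; rewrite -e leqNgt row_lt_last_col.
Qed.

End Construction.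

(** * Choice of the shift, and the theorem *)

Lemma good_labels_tall n q : 2 <= q -> q.+2 <= n ->
  exists a b g, good_labels n q.+1 a b g.
Proof.
move=> q2 nq; have [s [s_lt s_inj add_s_inj]] := exists_permutation_add_mod_inj q.
pose o := ~~ odd n : nat.
have on : odd (n - o) by rewrite /o; case: (boolP (odd n)) => /=; lia.
have o1 : o <= 1 by rewrite /o; case: odd.
have [tall|short] := ltnP (q * q).+1 n.
  exists (vlabel_l q), (vlabel_r n q s), (elabel n q o 0).
  have k_lt : o + 0 < n by lia.
  apply: (construction_good _ _ _ _ s) => // [i i' hi hi'|i j hi hj e].
    have r0 u : u < n -> rotate_from o n 0 u = u by apply: rotate_from0; lia.
    by rewrite !r0 // -!mulnSr => /eqP; rewrite eqn_mul2r => /eqP.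
  have : i * (q * q).+1 + rotate_from o n 0 i + row_base n q
      < s j + n * j + col_base n q by apply: row_lt_col.
  by rewrite e ltnn.
have r_lt k i : o + k < n -> i < n -> rotate_from o n k i < (q * q).+1.
  by move=> hk hi; apply: leq_trans short; apply: rotate_from_lt.
(* The row index and its rotated value are quotient and remainder by q^2 + 1. Two shifts are allowed
   because rows under different shifts get compared. *)
have row_eq k k' i i' : o + k < n -> o + k' < n -> i < n -> i' < n ->
    i * (q * q).+1 + rotate_from o n k i =
    i' * (q * q).+1 + rotate_from o n k' i' ->
  i = i' /\ rotate_from o n k i = rotate_from o n k' i'.
  move=> hk hk' hi hi' e; have := congr1 (divn^~ (q * q).+1) e.
  rewrite !divnMDl // !divn_small ?r_lt // !addn0 => ei.
  by split=> //; move: e; rewrite {1}ei => /addnI.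
pose row k i := i * (q * q).+1 + rotate_from o n k i + row_base n q.
pose col j := s j + n * j + col_base n q.
have kn (k : 'I_(n - o)) : o + k < n by have := ltn_ord k; lia.
have [/existsP[k /forallP good]|/existsPn bad] := boolP
    [exists k : 'I_(n - o), forall i : 'I_n, forall j : 'I_q, row k i != col j].
  exists (vlabel_l q), (vlabel_r n q s), (elabel n q o k).
  apply: (construction_good _ _ _ _ s) => // [i i' hi hi'|i j hi hj].
    by case/row_eq.
  by have /forallP/(_ (Ordinal hj))/eqP := good (Ordinal hi).
have coll (k : 'I_(n - o)) : exists j : 'I_q, [exists i : 'I_n, row k i == col j].
  have /forallPn[i /forallPn[j /negPn e]] := bad k.
  by exists j; apply/existsP; exists i.
(* Up to the shift, row weights are at least [n] apart, so a column determines
   the row it collides with and then [k]; but there are more shifts than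
   columns. *)
have : injective (fun k => xchoose (coll k)).
  move=> k k' ej; have /existsP[i /eqP e] := xchooseP (coll k).
  have /existsP[i' /eqP e'] := xchooseP (coll k').
  (* Only rows from [o] on reveal the shift. As o <= 1, it suffices to exclude row 0, which is
     lighter than each of the q columns. *)
  have oi : o <= i.
    case: (posnP i) => [i0|]; last by lia.
    have : row k 0 < col (xchoose (coll k)) by apply: row0_lt_col.
    by rewrite -e i0 ltnn.
  move: e'; rewrite -ej -e => /addIn/esym.
  case/row_eq=> // <- er; apply/ord_inj.
  by apply: (rotate_from_shift_inj o n k k' i); rewrite ?oi ?ltn_ord ?kn.
by move/leq_card; rewrite !card_ord; lia.
Qed.

Theorem theorem2p2 (n m : nat) (hn : 3 <= n) (hm : 3 <= m) (hnm : n <> m) :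
  weak_ordered_super_TAT_graph (Knm n m).
Proof.
have [a [b [g good]]] : exists a b g, good_labels n m a b g.
  (* The smaller side is written q.+1; transposing the array handles n < m. *)
  have [mn|nm|mn] := ltngtP m n; last by case: hnm.
    by case: m hm mn {hnm} => // q hq mn; apply: good_labels_tall.
  case: n hn nm {hnm} => // q hq nm.
  have [a [b [g /good_labelsC good]]] := good_labels_tall m q hq nm.
  by exists b, a, (fun j i => g i j).
by apply: Knm_weak_ordered_super_TAT good; lia.
Qed.
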